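(* Let $n\in\mathbb N$ and let $S\subset\mathbb R^n$ be a nondegenerate $n$-dimensional simplex. With the notation $\alpha(B_n;S)$, $l_{ij}$, $h_j$, $r$, $\sigma$ of the context, the following equalities are true: $$\alpha(B_n;S)=\sum_{j=1}^{n+1}\Bigl(\sum_{i=1}^n l_{ij}^2\Bigr)^{1/2},$$ $$\alpha(B_n;S)=\sum_{j=1}^{n+1}\frac{1}{h_j},$$ $$\alpha(B_n;S)=\frac1r,$$ $$\alpha(B_n;S)=\frac{\sigma}{n\,\mathrm{vol}(S)}.$$
   Context: $B_n=\{x\in\mathbb R^n:\|x\|\le 1\}$ is the closed Euclidean unit ball. For a convex body $C\subset\mathbb R^n$ and a nondegenerate simplex $S\subset\mathbb R^n$, $\tau S$ denotes the image of $S$ under the homothety with center at the center of gravity of $S$ and ratio $\tau$; $\alpha(C;S)$ is the minimal $\tau>0$ such that $C$ is contained in a translate of $\tau S$. Let $x^{(j)}=(x^{(j)}_1,\dots,x^{(j)}_n)$, $1\le j\le n+1$, be the vertices of $S$, and let $\mathbf A$ be the $(n+1)\times(n+1)$ matrix whose $j$-th row is $(x^{(j)}_1,\dots,x^{(j)}_n,1)$; it is nondegenerate. Write $\mathbf A^{-1}=(l_{ij})$. The basic Lagrange polynomials are $\lambda_j(x)=l_{1j}x_1+\dots+l_{nj}x_n+l_{n+1,j}$; they satisfy $\lambda_j(x^{(k)})=\delta_{jk}$ (they are the barycentric coordinates with respect to $S$). $\Gamma_j$ is the hyperplane $\lambda_j(x)=0$ and $\Sigma_j$ is the $(n-1)$-dimensional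 face of $S$ contained in $\Gamma_j$ (the face opposite to $x^{(j)}$). $h_j$ is the height of $S$ from the vertex $x^{(j)}$, i.e. the distance from $x^{(j)}$ to $\Gamma_j$. $r$ is the inradius of $S$, i.e. the maximum of the radii of balls contained in $S$. $\sigma_j$ is the $(n-1)$-dimensional measure of $\Sigma_j$ and $\sigma=\sum_{j=1}^{n+1}\sigma_j$. $\mathrm{vol}(S)$ is the $n$-dimensional volume of $S$. *)

(* Defs.v *)
From HB Require Import structures.
From mathcomp Require Import all_boot all_order all_algebra.
From mathcomp Require Import all_classical all_reals all_analysis.

Set Implicit Arguments.
Unset Strict Implicit.
Unset Printing Implicit Defensive.

Import Order.TTheory GRing.Theory Num.Theory.
Local Open Scope classical_set_scope.
Local Open Scope ring_scope.

Section LebesgueTuple.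
Context {R : realType}.
(* [measurableTypeR R] is [R] with its Borel sigma-algebra, the type on which
   [lebesgue_measure] lives. *)
Local Notation B := (measurableTypeR R).

Definition tuple_consp n (p : B * n.-tuple B) : n.+1.-tuple B :=
  [tuple of p.1 :: p.2].

Lemma measurable_tuple_consp n : measurable_fun setT (@tuple_consp n).
Proof. exact: measurable_cons. Qed.

Section LebesgueCons.
Variables (n : nat) (mu : {sigma_finite_measure set (n.-tuple B) -> \bar R}).

Definition lebesgue_cons : set (n.+1.-tuple B) -> \bar R :=
  pushforward (lebesgue_measure \x mu)%E (@tuple_consp n).

Let lebesgue_cons0 : lebesgue_cons set0 = 0%E.
Proof. by rewrite /lebesgue_cons /pushforward preimage_set0 measure0. Qed.

Let lebesgue_cons_ge0 A : (0 <= lebesgue_cons A)%E.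
Proof. by rewrite /lebesgue_cons /pushforward measure_ge0. Qed.

Let lebesgue_cons_sigma_additive : semi_sigma_additive lebesgue_cons.
Proof.
have mpre A : measurable A -> measurable (@tuple_consp n @^-1` A).
  by move=> mA; rewrite -[X in measurable X]setTI; exact: measurable_tuple_consp.
move=> F mF tF mUF; rewrite /lebesgue_cons /pushforward preimage_bigcup.
apply: measure_semi_sigma_additive.
- by move=> i; exact: mpre.
- apply/trivIsetP => /= i j _ _ ij; rewrite -preimage_setI.
  by move/trivIsetP : tF => /(_ _ _ _ _ ij) ->//; rewrite preimage_set0.
- by rewrite -preimage_bigcup; exact: mpre.
Qed.

HB.instance Definition _ := isMeasure.Build _ _ _ lebesgue_cons
  lebesgue_cons0 lebesgue_cons_ge0 lebesgue_cons_sigma_additive.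

Let lebesgue_cons_sigma_finite : sigma_finite setT lebesgue_cons.
Proof.
have /sigma_finiteP[F [FT ndF Foo]] := sigma_finiteT (@lebesgue_measure R).
have /sigma_finiteP[G [GT ndG Goo]] := sigma_finiteT mu.
pose g (t : n.+1.-tuple B) : B * n.-tuple B := (thead t, [tuple of behead t]).
have gK : cancel (@tuple_consp n) g.
  by move=> [a t]; congr (_, _); apply: val_inj.
have mg : measurable_fun setT g.
  apply: measurable_fun_pair; first exact: measurable_tnth.
  exact: measurable_behead.
exists (fun k => g @^-1` (F k `*` G k)).
  apply/esym; rewrite -subTset => t _.
  have [i _ Fi] : (\bigcup_i F i) (g t).1 by rewrite -FT.
  have [j _ Gj] : (\bigcup_j G j) (g t).2 by rewrite -GT.
  exists (maxn i j) => //; split.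
  - by move: (g t).1 Fi; exact/subsetPset/ndF/leq_maxl.
  - by move: (g t).2 Gj; exact/subsetPset/ndG/leq_maxr.
move=> k; have [mF Fk] := Foo k; have [mG Gk] := Goo k; split.
  by rewrite -[X in measurable X]setTI; apply: mg => //; exact: measurableX.
rewrite /lebesgue_cons /pushforward -comp_preimage.
rewrite (_ : g \o _ = id); last exact/funext.
rewrite preimage_id product_measure1E//.
by rewrite lte_mul_pinfty// ge0_fin_numE.
Qed.

HB.instance Definition _ := Measure_isSigmaFinite.Build _ _ _ lebesgue_cons
  lebesgue_cons_sigma_finite.

End LebesgueCons.

(* Lebesgue measure on R^n, as the n-fold product of [lebesgue_measure]. *)
Fixpoint lebesgue_tuple n : {sigma_finite_measure set (n.-tuple B) -> \bar R} :=
  match n with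
  | 0 => \d_([tuple] : 0.-tuple B)
  | m.+1 => lebesgue_cons (lebesgue_tuple m)
  end.

End LebesgueTuple.

Section Simplex.
Context {R : realType}.

Definition volume n (A : set 'rV[R]_n) : \bar R :=
  lebesgue_tuple n
    [set t : n.-tuple (measurableTypeR R) | A (\row_i tnth t i)].

(* The k-dimensional measure of a subset of a k-dimensional affine subspace of
   R^n: the Lebesgue measure of its coordinates in an orthonormal frame of that
   subspace (origin [o], directions the rows of [Q]).  For Borel [F] the value
   does not depend on the frame. *)
Definition flat_measure k n (F : set 'rV[R]_n) : \bar R :=
  xget 0%E [set v | exists (o : 'rV[R]_n) (Q : 'M[R]_(k, n)),
    [/\ Q *m Q^T = 1%:M,
        F `<=` [set o + t *m Q | t in [set: 'rV[R]_k]] &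
        v = volume [set t : 'rV[R]_k | F (o + t *m Q)]]].

(* The norm of ['rV[R]_n] in the library is the sup norm. *)
Definition enorm n (v : 'rV[R]_n) : R := Num.sqrt (\sum_i v 0 i ^+ 2).

Definition eball n (c : 'rV[R]_n) (rho : R) : set 'rV[R]_n :=
  [set y | enorm (y - c) <= rho].

(* The junk value 0 of [minimum] and [maximum] is returned when the extremum
   does not exist. *)
Definition minimum (A : set R) : R := xget 0 [set m | A m /\ lbound A m].
Definition maximum (A : set R) : R := xget 0 [set m | A m /\ ubound A m].

Section Vertices.
Context {n : nat}.
Implicit Type x : 'I_(n + 1) -> 'rV[R]_n.

Definition affinely_independent x : Prop :=
  forall c : 'I_(n + 1) -> R,
    \sum_j c j = 0 -> \sum_j c j *: x j = 0 -> forall j, c j = 0.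

Definition hull x (P : pred 'I_(n + 1)) : set 'rV[R]_n :=
  [set y | exists t : 'I_(n + 1) -> R,
    [/\ forall j, 0 <= t j, forall j, ~~ P j -> t j = 0,
        \sum_j t j = 1 & y = \sum_j t j *: x j]].

Definition simplex x : set 'rV[R]_n := hull x predT.

Definition face x j : set 'rV[R]_n := hull x (predC1 j).

Definition centroid x : 'rV[R]_n := (n + 1)%:R^-1 *: \sum_j x j.

Definition scaled_simplex (tau : R) x : set 'rV[R]_n :=
  [set centroid x + tau *: (y - centroid x) | y in simplex x].

Definition alpha (C : set 'rV[R]_n) x : R :=
  minimum [set tau | 0 < tau /\
    exists v : 'rV[R]_n, C `<=` [set v + y | y in scaled_simplex tau x]].

Definition vertex_matrix x : 'M[R]_(n + 1) :=
  row_mx (\matrix_j x j) (const_mx 1).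

(* [l x i j]; the index [n+1] of the last row is [rshift n ord0]. *)
Definition l x : 'M[R]_(n + 1) := invmx (vertex_matrix x).

Definition lagrange x j (y : 'rV[R]_n) : R :=
  \sum_(i < n) l x (lshift 1 i) j * y 0 i + l x (rshift n ord0) j.

Definition facet_plane x j : set 'rV[R]_n := [set y | lagrange x j y = 0].

Definition height x j : R :=
  inf [set enorm (x j - y) | y in facet_plane x j].

Definition inradius x : R :=
  maximum [set rho | 0 < rho /\ exists c, eball c rho `<=` simplex x].

Definition facet_area x j : R := fine (flat_measure n.-1 (face x j)).

Definition surface_area x : R := \sum_j facet_area x j.

End Vertices.
End Simplex.

(* Main.v *)
Require Import Defs.
From HB Require Import structures.
From mathcomp Require Import all_boot all_order all_algebra.
From mathcomp Require Import all_classical all_reals all_analysis.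
From mathcomp Require Import unstable measurable_realfun ring lra.
(* [lagrange] is shadowed by the libraries. *)
Import Defs.

Set Implicit Arguments.
Unset Strict Implicit.
Unset Printing Implicit Defensive.

Import Order.TTheory GRing.Theory Num.Theory numFieldNormedType.Exports.
Local Open Scope classical_set_scope.
Local Open Scope ring_scope.

(* Let g_j be the gradient of the barycentric coordinate lambda_j.  By
   Cauchy-Schwarz the ball B(c, rho) lies in S iff rho |g_j| <= lambda_j(c) for
   all j.  Summing over j gives rho <= 1 / sum |g_j|, with equality at the point
   whose barycentric coordinates are proportional to the |g_j|.  Since B_n is
   contained in a translate of tau S iff S contains a ball of radius 1/tau, this
   yields alpha = sum |g_j| = 1/r, and h_j = 1/|g_j| by Cauchy-Schwarz again.

   For the surface formula one needs n vol(S) = h_j sigma_j.  In the coordinates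
   given by the direction from a point of the facet to x^(j) and an orthonormal
   frame of the facet hyperplane, which scale the volume by h_j, the slice of S
   at lambda_j = a is the facet shrunk by the factor 1 - a, and the integral of
   (1 - a)^(n-1) over [0, 1] is 1/n.  The effect of a linear map on the product
   Lebesgue measure follows from Fubini for the block shears and dilations into
   which Gaussian elimination decomposes it. *)

(** * Euclidean inner product and norm *)

Section Enorm.
Context {R : realType} {n : nat}.
Implicit Types (u v w : 'rV[R]_n) (a : R).

Definition dot u v : R := (u *m v^T) 0 0.

Lemma dotE u v : dot u v = \sum_i u 0 i * v 0 i.
Proof. by rewrite /dot mxE; apply: eq_bigr => i _; rewrite mxE. Qed.

Lemma dotDr u v w : dot u (v + w) = dot u v + dot u w.
Proof. by rewrite /dot linearD mulmxDr mxE. Qed.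

Lemma dotZl a u v : dot (a *: u) v = a * dot u v.
Proof. by rewrite /dot -scalemxAl mxE. Qed.

Lemma dotZr a u v : dot u (a *: v) = a * dot u v.
Proof. by rewrite /dot linearZ -scalemxAr mxE. Qed.

Lemma dotNr u v : dot u (- v) = - dot u v.
Proof. by rewrite -scaleN1r dotZr mulN1r. Qed.

Lemma dotBr u v w : dot u (v - w) = dot u v - dot u w.
Proof. by rewrite dotDr dotNr. Qed.

Lemma dotC u v : dot u v = dot v u.
Proof. by rewrite !dotE; apply: eq_bigr => i _; rewrite mulrC. Qed.

Lemma dot_ge0 u : 0 <= dot u u.
Proof. by rewrite dotE sumr_ge0// => i _; rewrite -expr2 sqr_ge0. Qed.

Lemma dot_eq0 u : (dot u u == 0) = (u == 0).
Proof.
apply/eqP/eqP => [|->]; last by rewrite /dot mul0mx mxE.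
rewrite dotE => /eqP; rewrite psumr_eq0 => [/allP u0|i _]; last first.
  by rewrite -expr2 sqr_ge0.
apply/rowP => i; rewrite mxE.
by have := u0 i (mem_index_enum i); rewrite /= mulf_eq0 orbb => /eqP.
Qed.

Lemma enormE u : enorm u = Num.sqrt (dot u u).
Proof. by rewrite /enorm dotE; congr Num.sqrt; apply: eq_bigr => i _. Qed.

Lemma enorm_sqr u : enorm u ^+ 2 = dot u u.
Proof. by rewrite enormE sqr_sqrtr// dot_ge0. Qed.

Lemma enorm_ge0 u : 0 <= enorm u.
Proof. by rewrite enormE sqrtr_ge0. Qed.

Lemma enorm_eq0 u : (enorm u == 0) = (u == 0).
Proof. by rewrite -dot_eq0 -enorm_sqr sqrf_eq0. Qed.

Lemma enorm_gt0 u : (0 < enorm u) = (u != 0).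
Proof. by rewrite lt_def enorm_ge0 andbT enorm_eq0. Qed.

Lemma enormZ a u : enorm (a *: u) = `|a| * enorm u.
Proof.
by rewrite !enormE dotZl dotZr mulrA -expr2 sqrtrM ?sqr_ge0// sqrtr_sqr.
Qed.

Lemma enormN u : enorm (- u) = enorm u.
Proof. by rewrite -scaleN1r enormZ normrN1 mul1r. Qed.

(** The squared norm of [enorm v *: u - enorm u *: v] is [2 * enorm u * enorm v * (enorm u * enorm v
    - dot u v)], and it is nonnegative. *)
Lemma CauchySchwarz_enorm u v : dot u v <= enorm u * enorm v.
Proof.
have [->|u0] := eqVneq u 0.
  by rewrite /dot mul0mx mxE mulr_ge0 ?enorm_ge0.
have [->|v0] := eqVneq v 0.
  by rewrite /dot trmx0 mulmx0 mxE mulr_ge0 ?enorm_ge0.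
have uv0 : 0 < enorm u * enorm v by rewrite mulr_gt0 ?enorm_gt0.
have := dot_ge0 (enorm v *: u - enorm u *: v).
rewrite dotBr dotC dotBr [X in _ - X]dotC dotBr !dotZl !dotZr.
rewrite -!enorm_sqr [dot v u]dotC => h.
rewrite -subr_ge0 -(pmulr_rge0 _ (mulr_gt0 (ltr0n R 2) uv0)).
by move: h; congr (0 <= _); ring.
Qed.

Lemma enorm_coord u i : `|u 0 i| <= enorm u.
Proof.
rewrite enormE -sqrtr_sqr ler_wsqrtr// dotE (bigD1 i)//= -expr2 lerDl.
by rewrite sumr_ge0// => j _; rewrite -expr2 sqr_ge0.
Qed.

End Enorm.

(** * Extrema of sets of reals *)

Lemma maximumE (R : realType) (A : set R) m :
  A m -> ubound A m -> maximum A = m.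
Proof.
move=> Am Aub; rewrite /maximum; case: xgetP => [y _ [Ay yub]|/(_ m)[]//].
by apply/eqP; rewrite eq_le yub// Aub.
Qed.

Lemma minimumE (R : realType) (A : set R) m :
  A m -> lbound A m -> minimum A = m.
Proof.
move=> Am Alb; rewrite /minimum; case: xgetP => [y _ [Ay ylb]|/(_ m)[]//].
by apply/eqP; rewrite eq_le ylb// Alb.
Qed.

(** * Barycentric coordinates, inradius, [alpha] and heights *)

Section Barycentric.
Context {R : realType} {n : nat}.
Variable x : 'I_(n + 1) -> 'rV[R]_n.
Hypothesis hx : affinely_independent x.

Definition grad j : 'rV[R]_n := \row_i l x (lshift 1 i) j.

Lemma enorm_grad j :
  enorm (grad j) = Num.sqrt (\sum_(i < n) l x (lshift 1 i) j ^+ 2).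
Proof. by congr Num.sqrt; apply: eq_bigr => i _; rewrite mxE. Qed.

Lemma lagrangeE j y : lagrange x j y = (row_mx y 1 *m l x) 0 j.
Proof.
rewrite mxE big_split_ord/= big_ord1 row_mxEr mxE mul1r; congr (_ + _).
by apply: eq_bigr => i _; rewrite row_mxEl mulrC.
Qed.

Lemma lagrangeB j y z : lagrange x j y - lagrange x j z = dot (grad j) (y - z).
Proof.
rewrite dotE /lagrange opprD addrACA subrr addr0 -sumrB.
by apply: eq_bigr => i _; rewrite !mxE mulrBr.
Qed.

(** One product records both the weighted combination of the vertices and the total weight;
    inverting it yields all the barycentric identities below. *)
Lemma vertex_matrix_mul (t : 'I_(n + 1) -> R) :
  (\row_k t k) *m vertex_matrix x = row_mx (\sum_k t k *: x k) (\sum_k t k)%:M.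
Proof.
rewrite /vertex_matrix mul_mx_row; congr row_mx; apply/rowP => i.
  by rewrite mxE summxE; apply: eq_bigr => k _; rewrite !mxE.
by rewrite mxE ord1 mxE mulr1n; apply: eq_bigr => k _; rewrite !mxE mulr1.
Qed.

(** A vector in the left kernel is a list of weights with zero sum and zero combination, which
    affine independence forces to vanish. *)
Lemma vertex_matrix_unit : vertex_matrix x \in unitmx.
Proof.
rewrite -row_free_unit -kermx_eq0; apply/eqP/row_matrixP => i; rewrite row0.
set u := row i _.
have : u *m vertex_matrix x = row_mx 0 0.
  by rewrite row_mx0; apply: sub_kermxP; rewrite row_sub.
have {1}-> : u = \row_k u 0 k by apply/rowP => k; rewrite mxE.
rewrite vertex_matrix_mul => /eq_row_mx[ux /matrixP/(_ 0 0)].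
rewrite !mxE mulr1n => us.
by apply/rowP => k; rewrite (hx us ux) mxE.
Qed.

Lemma lagrange_comb (t : 'I_(n + 1) -> R) j : \sum_k t k = 1 ->
  lagrange x j (\sum_k t k *: x k) = t j.
Proof.
move=> t1; have := vertex_matrix_mul t; rewrite t1 lagrangeE => <-.
by rewrite mulmxK ?vertex_matrix_unit// mxE.
Qed.

Lemma lagrange_vertex j k : lagrange x j (x k) = (j == k)%:R.
Proof.
have {1}-> : x k = \sum_i (i == k)%:R *: x i.
  rewrite (bigD1 k)//= eqxx scale1r big1 ?addr0// => i /negPf->.
  by rewrite scale0r.
rewrite lagrange_comb// (bigD1 k)//= eqxx big1 ?addr0// => i /negPf->//.
Qed.

Lemma lagrange_decomp y :
  \sum_k lagrange x k y *: x k = y /\ \sum_k lagrange x k y = 1.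
Proof.
have := vertex_matrix_mul (fun k => lagrange x k y).
have -> : \row_k lagrange x k y = row_mx y 1 *m l x.
  by apply/rowP => k; rewrite mxE lagrangeE.
rewrite mulmxKV ?vertex_matrix_unit// => /eq_row_mx[yE /matrixP/(_ 0 0)].
by rewrite !mxE !mulr1n => y1; split.
Qed.

Lemma sum_lagrange y : \sum_k lagrange x k y = 1.
Proof. by have [] := lagrange_decomp y. Qed.

Lemma hullP P y : hull x P y <->
  (forall k, 0 <= lagrange x k y) /\ forall k, ~~ P k -> lagrange x k y = 0.
Proof.
have [yE y1] := lagrange_decomp y; split=> [[t [t0 tP t1 ->]]|[y0 yP]].
  by split=> k; rewrite lagrange_comb//; exact: tP.
by exists (fun k => lagrange x k y); split.
Qed.

Lemma simplexP y : simplex x y <-> forall k, 0 <= lagrange x k y.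
Proof. by rewrite /simplex hullP; split=> [[]|]. Qed.

Lemma faceP j y :
  face x j y <-> (forall k, 0 <= lagrange x k y) /\ lagrange x j y = 0.
Proof.
rewrite /face hullP; split=> -[y0 yj]; split=> //; first by rewrite yj//= eqxx.
by move=> k; rewrite /= negbK => /eqP->.
Qed.

Hypothesis n_gt0 : (0 < n)%N.

Lemma exists_other_vertex (j : 'I_(n + 1)) : exists k, k != j.
Proof.
have [j0|j0] := eqVneq j (rshift n ord0); last first.
  by exists (rshift n ord0); rewrite eq_sym.
by exists (lshift 1 (Ordinal n_gt0)); rewrite j0 -val_eqE/= addn0 neq_ltn n_gt0.
Qed.

(** The coordinate takes the value 1 at [x j] and 0 at any other vertex, so its linear part cannot
    vanish. *)
Lemma grad_neq0 j : grad j != 0.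
Proof.
have [k kj] := exists_other_vertex j.
apply/eqP => g0; have := lagrangeB j (x j) (x k).
rewrite !lagrange_vertex eqxx eq_sym (negPf kj) subr0 g0 /dot mul0mx mxE.
by move/eqP; rewrite oner_eq0.
Qed.

Lemma enorm_grad_gt0 j : 0 < enorm (grad j).
Proof. by rewrite enorm_gt0 grad_neq0. Qed.

Definition gsum : R := \sum_j enorm (grad j).

Lemma gsum_gt0 : 0 < gsum.
Proof.
rewrite /gsum (bigD1 (rshift n ord0))//= ltr_pwDl ?enorm_grad_gt0//.
by rewrite sumr_ge0// => j _; rewrite enorm_ge0.
Qed.

Lemma eball_sub_simplex c rho : 0 <= rho -> eball c rho `<=` simplex x <->
  forall j, rho * enorm (grad j) <= lagrange x j c.
Proof.
move=> rho0; split=> [cS j|cS y cy].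
  (* The point of the ball where [lagrange x j] is smallest: move from [c] by [rho] against the
     gradient. *)
  have /cS/simplexP/(_ j) : eball c rho (c - (rho / enorm (grad j)) *: grad j).
    rewrite /eball/= addrAC subrr add0r enormN enormZ ger0_norm.
      by rewrite divfK// enorm_eq0 grad_neq0.
    by rewrite divr_ge0// enorm_ge0.
  rewrite -[lagrange x j _](subrK (lagrange x j c)) lagrangeB.
  rewrite addrAC subrr add0r dotNr dotZr -enorm_sqr expr2 mulrA.
  rewrite divfK ?enorm_eq0 ?grad_neq0//.
  by rewrite addrC subr_ge0.
apply/simplexP => j; have := cS j.
rewrite -(subrK (lagrange x j c) (lagrange _ _ y)).
rewrite lagrangeB -[y - c]opprK dotNr => lc; rewrite addrC subr_ge0.
rewrite (le_trans (CauchySchwarz_enorm _ _))// (le_trans _ lc)//.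
by rewrite enormN mulrC ler_wpM2r ?enorm_ge0.
Qed.

(** These weights make the quotients [lagrange x j / enorm (grad j)], the distances to the facet
    hyperplanes, all equal to [gsum^-1]. *)
Definition incenter : 'rV[R]_n := \sum_k (enorm (grad k) / gsum) *: x k.

Lemma lagrange_incenter j : lagrange x j incenter = enorm (grad j) / gsum.
Proof. by rewrite lagrange_comb// -mulr_suml divff// gt_eqF ?gsum_gt0. Qed.

Lemma inball_sub_simplex : eball incenter gsum^-1 `<=` simplex x.
Proof.
apply/eball_sub_simplex => [|j]; first by rewrite invr_ge0 ltW ?gsum_gt0.
by rewrite lagrange_incenter mulrC.
Qed.

Lemma radius_le c rho :
  0 <= rho -> eball c rho `<=` simplex x -> rho <= gsum^-1.
Proof.
move=> rho0 /(eball_sub_simplex _ rho0) h.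
rewrite -[_^-1]mul1r ler_pdivlMr ?gsum_gt0// -(sum_lagrange c) mulr_sumr.
exact: ler_sum.
Qed.

Lemma inradiusE : inradius x = gsum^-1.
Proof.
apply: maximumE => [|rho [rho0 [c]]]; last exact/radius_le/ltW.
split; first by rewrite invr_gt0 gsum_gt0.
by exists incenter; exact: inball_sub_simplex.
Qed.

(** Solves [b = v + G + tau (y - G)] for [y], with [G] the centroid. This inverse map turns a unit
    ball into a ball of radius [tau^-1]. *)
Lemma scaled_simplexP tau v b : 0 < tau ->
  [set v + y | y in scaled_simplex tau x] b <->
  simplex x (tau^-1 *: (b - v - (1 - tau) *: centroid x)).
Proof.
move=> tau0; have tauN0 : tau != 0 by rewrite gt_eqF.
split=> [[_ [y Sy <-] <-]|Sb].
  have -> : v + (centroid x + tau *: (y - centroid x)) - v -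
      (1 - tau) *: centroid x = tau *: y.
    by apply/rowP => i; rewrite !mxE; ring.
  by rewrite scalerA mulVf// scale1r.
set y := tau^-1 *: _ in Sb.
exists (centroid x + tau *: (y - centroid x)); first by exists y.
rewrite scalerBr scalerA divff// scale1r.
by apply/rowP => i; rewrite !mxE; ring.
Qed.

Lemma alphaE : alpha (eball 0 1) x = gsum.
Proof.
have g0 := gsum_gt0.
apply: minimumE => [|tau [tau0 [v vS]]].
  (* The translation for which the inverse map of [scaled_simplexP] sends the origin to the
     incenter. *)
  split=> //; exists (- (gsum *: incenter) - (1 - gsum) *: centroid x) => b b1.
  apply/scaled_simplexP => //.
  apply: inball_sub_simplex; rewrite /eball/=.
  have -> : gsum^-1 *:
      (b - (- (gsum *: incenter) - (1 - gsum) *: centroid x) -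
      (1 - gsum) *: centroid x) - incenter = gsum^-1 *: b.
    rewrite opprB opprK addrCA addrAC subrr add0r scalerDr scalerA.
    by rewrite mulVf ?gt_eqF// scale1r addrK.
  rewrite enormZ gtr0_norm ?invr_gt0// ler_piMr ?invr_ge0 ?(ltW g0)//.
  by move: b1; rewrite /eball/= subr0.
rewrite -lef_pV2 ?posrE//.
(* The inverse map carries the unit ball onto the ball of radius [tau^-1] about the image of the
   origin, and that ball lies in the simplex. *)
apply: (@radius_le (tau^-1 *: (- v - (1 - tau) *: centroid x))).
  by rewrite invr_ge0 ltW.
move=> y yS.
set c := _ *: _ in yS.
have -> : y = tau^-1 *: (tau *: (y - c) - v - (1 - tau) *: centroid x).
  rewrite -addrA scalerDr scalerA mulVf ?gt_eqF// scale1r.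
  by rewrite subrK.
apply/scaled_simplexP => //; apply: vS; rewrite /eball/= subr0 enormZ.
by rewrite gtr0_norm// -ler_pdivlMl// mulr1.
Qed.

Lemma heightE j : height x j = (enorm (grad j))^-1.
Proof.
have gj := enorm_grad_gt0 j.
have gj0 : enorm (grad j) != 0 by rewrite gt_eqF.
have hlb : lbound [set enorm (x j - y) | y in facet_plane x j]
    (enorm (grad j))^-1.
  move=> _ [y yj <-]; rewrite -[_^-1]mul1r ler_pdivrMr// mulrC.
  apply: le_trans (CauchySchwarz_enorm _ _); rewrite -lagrangeB.
  by rewrite lagrange_vertex eqxx yj subr0.
apply/eqP; rewrite eq_le /height; apply/andP; split.
  apply: ge_inf; first by exists (enorm (grad j))^-1.
  (* The foot of the perpendicular from [x j] to the hyperplane. *)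
  exists (x j - (enorm (grad j) ^- 2) *: grad j).
    rewrite /facet_plane/= -[LHS](subrK (lagrange x j (x j))) lagrangeB.
    rewrite addrAC subrr add0r dotNr dotZr -enorm_sqr mulVf ?expf_neq0//.
    by rewrite lagrange_vertex eqxx addrC subrr.
  rewrite opprB addrC subrK enormZ ger0_norm ?invr_ge0 ?sqr_ge0//.
  by rewrite expr2 invfM -mulrA mulVf ?mulr1.
apply: lb_le_inf => //.
(* Any other vertex lies on the hyperplane, so the infimum is over a nonempty set. *)
have [k kj] := exists_other_vertex j.
exists (enorm (x j - x k)), (x k) => //.
by rewrite /facet_plane/= lagrange_vertex eq_sym (negPf kj).
Qed.

End Barycentric.

(** * Lebesgue measure on the line under translation and dilation *)

Section Line.
Context {R : realType}.
Local Notation B := (measurableTypeR R).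
Local Notation lambda := (@lebesgue_measure R).

(** The pushforward under the translation agrees with [lambda] on half-open intervals, which
    determine Lebesgue measure. *)
Lemma lebesgue_measure_translate (b : R) (A : set B) : measurable A ->
  lambda [set s | A (s + b)] = lambda A.
Proof.
move=> mA.
have mb : measurable_fun [set: B] (fun s : B => (s + b : B)).
  by apply: measurable_funD.
rewrite -[LHS]/(pushforward lambda (fun s : B => (s + b : B)) A).
apply/esym/lebesgue_measure_unique => //= _ [[u v]] _ <-.
rewrite /pushforward (_ : _ @^-1` _ = [set` `]u - b, v - b]]).
  rewrite !lebesgue_measure_itv/= !lte_fin ltrD2r -!EFinB.
  by rewrite (_ : v - b - (u - b) = v - u)//; ring.
by apply/seteqP; split=> s/=; rewrite !in_itv/= ltrBlDr lerBrDr.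
Qed.

Lemma lebesgue_measure_scale (c : R) (A : set B) : c != 0 -> measurable A ->
  lambda [set s | A (s * c)] = (`|c|^-1%:E * lambda A)%E.
Proof.
(* A negative factor reduces to its opposite by reflection invariance of [lambda]. *)
wlog c0 : c A / 0 < c.
  move=> h c0 mA; have [cn|cp|c0'] := ltgtP c 0;
    [|exact: h|by rewrite c0' eqxx in c0].
  rewrite -normrN -(h (- c))//; [|by rewrite oppr_gt0|by rewrite oppr_eq0].
  rewrite -lebesgue_measureN; last first.
    by rewrite -[X in measurable X]setTI; apply: mulrr_measurable.
  by congr lambda; apply/seteqP; split=> s/=; rewrite mulrN mulNr.
move=> _ mA.
have mc : measurable_fun [set: B] (fun s : B => (s * c : B)).
  exact: mulrr_measurable.
have cge0 : 0 <= c by exact: ltW.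
(* Multiplying the pushforward by [c] corrects interval lengths, so uniqueness of Lebesgue measure
   identifies [m] with [lambda]. *)
pose m := mscale (NngNum cge0) (pushforward lambda (fun s : B => (s * c : B))).
have -> : lambda A = m mc A.
  apply: lebesgue_measure_unique => //= _ [[u v]] _ <-.
  rewrite /m /mscale/= /pushforward (_ : _ @^-1` _ = [set` `]u / c, v / c]]).
    rewrite !lebesgue_measure_itv/= !lte_fin ltr_pM2r ?invr_gt0// -!EFinB.
    case: ifPn; rewrite ?mule0// -EFinM => _; congr EFin.
    by field; rewrite gt_eqF.
  by apply/seteqP; split=> s/=; rewrite !in_itv/= ltr_pdivrMr// ler_pdivlMr.
rewrite /m /mscale/= /pushforward muleA -EFinM gtr0_norm// mulVf ?gt_eqF//.
by rewrite mul1e.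
Qed.

End Line.

(** * Measurability of sets of row vectors *)

Section RowMeasurability.
Context {R : realType}.
Local Notation B := (measurableTypeR R).

Definition row_of_tuple n (t : n.-tuple B) : 'rV[R]_n := \row_i tnth t i.

(** [volume] reads a set of rows through tuples, so measurability is transported along the same
    map. *)
Definition row_measurable n (A : set 'rV[R]_n) : Prop :=
  measurable [set t : n.-tuple B | A (row_of_tuple t)].

Definition coord_measurable d (T : measurableType d) n
    (f : T -> 'rV[R]_n) : Prop :=
  forall i, measurable_fun [set: T] (fun t => f t 0 i : B).

Lemma coord_measurable_preimage d (T : measurableType d) n (f : T -> 'rV[R]_n)
    (A : set 'rV[R]_n) :
  coord_measurable f -> row_measurable A -> measurable (f @^-1` A).
Proof.
move=> mf mA; pose h t : n.-tuple B := [tuple f t 0 i | i < n].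
have mh : measurable_fun [set: T] h.
  apply/measurable_fun_tnthP => i; apply: (eq_measurable_fun _ _ (mf i)) => t _.
  by rewrite /= tnth_mktuple.
rewrite (_ : f @^-1` A = [set: T] `&` h @^-1` [set t | A (row_of_tuple t)]).
  exact: mh.
rewrite setTI; apply/funext => t /=; congr (A _).
by apply/rowP => i; rewrite mxE tnth_mktuple.
Qed.

Lemma coord_measurable_row_of_tuple n : coord_measurable (@row_of_tuple n).
Proof.
move=> i; apply: (eq_measurable_fun _ _ (measurable_tnth i)) => t _.
by rewrite mxE.
Qed.

Lemma coord_measurable_cst d (T : measurableType d) n (v : 'rV[R]_n) :
  coord_measurable (fun _ : T => v).
Proof. by move=> i; exact: measurable_cst. Qed.

Lemma coord_measurableD d (T : measurableType d) n (f g : T -> 'rV[R]_n) :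
  coord_measurable f -> coord_measurable g ->
  coord_measurable (fun t => f t + g t).
Proof.
move=> mf mg i.
apply: (eq_measurable_fun _ _ (measurable_funD (mf i) (mg i))).
by move=> t _; rewrite mxE.
Qed.

Lemma coord_measurable_mul d (T : measurableType d) n p (f : T -> 'rV[R]_n)
    (M : 'M[R]_(n, p)) :
  coord_measurable f -> coord_measurable (fun t => f t *m M).
Proof.
move=> mf i.
have : measurable_fun [set: T] (\sum_k (fun t => f t 0 k * M k i : B)).
  elim/big_ind: _ => [|g h mg mh|k _]; first exact: measurable_cst.
    exact: measurable_funD.
  by apply: measurable_funM; [exact: mf|exact: measurable_cst].
apply: eq_measurable_fun => t _; rewrite mxE fct_sumE.
by apply: eq_bigr.
Qed.

Lemma coord_measurable_row_mx d (T : measurableType d) n (f : T -> B)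
    (g : T -> 'rV[R]_n) :
  measurable_fun [set: T] f -> coord_measurable g ->
  coord_measurable (fun t => row_mx (f t)%:M (g t) : 'rV_(1 + n)).
Proof.
move=> mf mg i; have [k ->|k ->] := fintype.split_ordP i.
  apply: (eq_measurable_fun _ _ mf) => t _.
  by rewrite row_mxEl ord1 mxE eqxx.
by apply: (eq_measurable_fun _ _ (mg k)) => t _; rewrite row_mxEr.
Qed.

Lemma row_measurable_affine n p (o : 'rV[R]_p) (M : 'M[R]_(n, p))
    (A : set 'rV[R]_p) :
  row_measurable A -> row_measurable [set u : 'rV_n | A (o + u *m M)].
Proof.
apply: (coord_measurable_preimage (f := fun t => o + row_of_tuple t *m M)).
apply: coord_measurableD; first exact: coord_measurable_cst.
by apply: coord_measurable_mul; exact: coord_measurable_row_of_tuple.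
Qed.

Lemma row_measurable_translate n (v : 'rV[R]_n) (A : set 'rV[R]_n) :
  row_measurable A -> row_measurable [set u | A (u + v)].
Proof.
move=> /(row_measurable_affine v 1%:M); rewrite /row_measurable/=.
by under eq_set do rewrite mulmx1 addrC.
Qed.

Lemma row_measurable_linear n p (M : 'M[R]_(n, p)) (A : set 'rV[R]_p) :
  row_measurable A -> row_measurable [set u : 'rV_n | A (u *m M)].
Proof.
move=> /(row_measurable_affine 0 M); rewrite /row_measurable/=.
by under eq_set do rewrite add0r.
Qed.

Lemma row_measurable_slice n (a : R) (A : set 'rV[R]_(1 + n)) :
  row_measurable A -> row_measurable [set u : 'rV_n | A (row_mx a%:M u)].
Proof.
apply: (coord_measurable_preimage (f := fun t => row_mx a%:M (row_of_tuple t))).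
apply: coord_measurable_row_mx; first exact: measurable_cst.
exact: coord_measurable_row_of_tuple.
Qed.

Lemma measurable_line_slice n (u : 'rV[R]_n) (A : set 'rV[R]_(1 + n)) :
  row_measurable A -> measurable [set a : B | A (row_mx a%:M u)].
Proof.
apply: (coord_measurable_preimage (f := fun a : B => row_mx a%:M u)).
apply: coord_measurable_row_mx; first exact: measurable_id.
exact: coord_measurable_cst.
Qed.

Lemma row_measurable_cons n (A : set 'rV[R]_(1 + n)) : row_measurable A ->
  measurable [set p : B * n.-tuple B | A (row_mx p.1%:M (row_of_tuple p.2))].
Proof.
apply: (coord_measurable_preimage
  (f := fun p : B * n.-tuple B => row_mx p.1%:M (row_of_tuple p.2))).
apply: coord_measurable_row_mx; first exact: measurable_fst.
move=> i.
apply: (measurableT_comp (coord_measurable_row_of_tuple i) measurable_snd).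
Qed.

End RowMeasurability.

Lemma volume_ge0 (R : realType) n (A : set 'rV[R]_n) : (0 <= volume A)%E.
Proof. exact: measure_ge0. Qed.

(** * Fubini for the first coordinate against the rest *)

Section VolumeSlices.
Context {R : realType}.
Local Notation B := (measurableTypeR R).
Local Notation lambda := (@lebesgue_measure R).
Variable n : nat.
Implicit Type A : set 'rV[R]_(1 + n).

Let section A : set (B * n.-tuple B) :=
  [set p | A (row_mx p.1%:M (row_of_tuple p.2))].

Let row_of_tuple_cons (a : B) (t : n.-tuple B) :
  row_of_tuple (tuple_consp (a, t)) = row_mx a%:M (row_of_tuple t)
    :> 'rV_(1 + n).
Proof.
apply/rowP => i; have [k ->|k ->] := fintype.split_ordP i.
  rewrite row_mxEl mxE [RHS]mxE ord1 eqxx mulr1n /=.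
  by rewrite (_ : lshift n 0 = ord0)//; exact: val_inj.
rewrite row_mxEr !mxE (_ : rshift 1 k = lift ord0 k) ?tnthS//.
exact: val_inj.
Qed.

Let volume_section A : volume A = (lambda \x lebesgue_tuple n)%E (section A).
Proof.
rewrite -[LHS]/((lambda \x lebesgue_tuple n)%E (@tuple_consp R n @^-1`
  [set t : (1 + n).-tuple B | A (row_of_tuple t)])).
congr (product_measure1 _ _ _); apply/funext => -[a t] /=.
by rewrite /section/preimage/= -row_of_tuple_cons.
Qed.

Let xsection_volume A a :
  lebesgue_tuple n (xsection (section A) a) =
  volume [set u : 'rV_n | A (row_mx a%:M u)].
Proof. by congr (lebesgue_tuple _ _); apply/funext => t; rewrite xsectionE. Qed.

(** Immediate from the recursive product definition of the measure: [\x] integrates the measures of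
    the sections at a fixed first coordinate. *)
Lemma volume_slices A :
  volume A = (\int[lambda]_a volume [set u : 'rV_n | A (row_mx a%:M u)])%E.
Proof.
by rewrite volume_section; apply: eq_integral => a _; rewrite -xsection_volume.
Qed.

Lemma measurable_volume_slices A : row_measurable A ->
  measurable_fun [set: B] (fun a => volume [set u : 'rV_n | A (row_mx a%:M u)]).
Proof.
move=> /row_measurable_cons/(measurable_fun_xsection (lebesgue_tuple n)).
by apply: eq_measurable_fun => a _; rewrite /= xsection_volume.
Qed.

(** Integration in the other order: [\x] and [\x^] agree by uniqueness of the product measure. *)
Lemma volume_line_slices A : row_measurable A ->
  volume A = (\int[lebesgue_tuple n]_t
    lambda [set a | A (row_mx a%:M (row_of_tuple t))])%E.
Proof.
move=> mA; rewrite volume_section.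
rewrite (@product_measure_unique _ _ _ _ _ _ _ (lambda \x^ lebesgue_tuple n)%E);
  last 2 first.
- by move=> *; exact: product_measure2E.
- exact: row_measurable_cons.
apply: eq_integral => t _ /=; congr lebesgue_measure.
by apply/funext => a; rewrite ysectionE.
Qed.

Lemma measurable_volume_line_slices A : row_measurable A ->
  measurable_fun [set: n.-tuple B]
    (fun t => lambda [set a | A (row_mx a%:M (row_of_tuple t))]).
Proof.
move=> /row_measurable_cons/(measurable_fun_ysection lambda).
apply: eq_measurable_fun => t _ /=; congr lebesgue_measure.
by apply/funext => a; rewrite ysectionE.
Qed.

(** Serves for maps that preserve the first coordinate; [volume_eq_line_slices] serves for those
    that preserve all the others. *)
Lemma volume_eq_slices A A' (c : R) : 0 <= c -> row_measurable A ->
  (forall a, volume [set u : 'rV_n | A' (row_mx a%:M u)] =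
     c%:E * volume [set u : 'rV_n | A (row_mx a%:M u)])%E ->
  (volume A' = c%:E * volume A)%E.
Proof.
move=> c0 mA E; rewrite !volume_slices -ge0_integralZl//.
  by apply: eq_integral => a _; rewrite E.
exact: measurable_volume_slices.
Qed.

Lemma volume_eq_line_slices A A' (c : R) :
  0 <= c -> row_measurable A -> row_measurable A' ->
  (forall u : 'rV_n, lambda [set a | A' (row_mx a%:M u)] =
     c%:E * lambda [set a | A (row_mx a%:M u)])%E ->
  (volume A' = c%:E * volume A)%E.
Proof.
move=> c0 mA mA' E; rewrite !volume_line_slices// -ge0_integralZl//.
  by apply: eq_integral => a _; rewrite E.
exact: measurable_volume_line_slices.
Qed.

End VolumeSlices.

(** * Volume under affine maps; cubes *)

Section VolumeAffine.
Context {R : realType}.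

Lemma row_mx_split n (u : 'rV[R]_(1 + n)) : u = row_mx (u 0 0)%:M (rsubmx u).
Proof.
rewrite -{1}(hsubmxK u); congr row_mx; apply/rowP => i.
rewrite ord1 !mxE eqxx; congr (u _ _); exact: val_inj.
Qed.

Lemma volume_translate n (v : 'rV[R]_n) (A : set 'rV[R]_n) :
  row_measurable A -> volume [set u | A (u + v)] = volume A.
Proof.
elim: n => [|n IH] in v A *; move=> mA.
  by congr volume; apply/funext => u /=; congr (A _); apply/rowP => -[].
change ('rV[R]_(1 + n)) in v; change (set 'rV[R]_(1 + n)) in A.
change (row_measurable (n := 1 + n) A) in mA.
change (volume [set u : 'rV[R]_(1 + n) | A (u + v)] = volume A).
rewrite (row_mx_split v); set a := v 0 0; set w := rsubmx v.
have mA1 := row_measurable_translate (row_mx a%:M 0) mA.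
(* The tail of [v] is removed inside each slice by induction, then its head along each line. *)
transitivity (volume [set u : 'rV_(1 + n) | A (u + row_mx a%:M 0)]).
  rewrite -[RHS]mul1e; apply: volume_eq_slices => // b; rewrite mul1e.
  rewrite -[RHS](IH w); last exact: (row_measurable_slice b mA1).
  congr volume; apply/funext => u /=; congr (A _).
  by rewrite !add_row_mx addr0.
rewrite -[RHS]mul1e; apply: volume_eq_line_slices => // u; rewrite mul1e.
rewrite -[RHS](lebesgue_measure_translate a); last exact: measurable_line_slice.
congr lebesgue_measure; apply/funext => b /=; congr (A _).
by rewrite add_row_mx addr0 -raddfD.
Qed.

(** The set on the left is a preimage under [M], hence the inverse determinant. The property passes
    to products, so elementary factors suffice. *)
Definition scales_volume n (M : 'M[R]_n) : Prop := forall A : set 'rV[R]_n,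
  row_measurable A ->
  volume [set u | A (u *m M)] = (`|\det M|^-1%:E * volume A)%E.

Lemma scales_volumeM n (M N : 'M[R]_n) :
  scales_volume M -> scales_volume N -> scales_volume (M *m N).
Proof.
move=> hM hN A mA.
have := hM _ (row_measurable_linear N mA); rewrite hN// muleA -EFinM.
rewrite det_mulmx normrM invfM => <-.
by congr volume; apply/funext => u /=; rewrite mulmxA.
Qed.

(** On the slice at first coordinate [a] the shear is the translation by [a *: w]. *)
Lemma scales_volume_ushear n (w : 'rV[R]_n) :
  scales_volume (block_mx 1%:M w 0 1%:M : 'M[R]_(1 + n)).
Proof.
move=> A mA; rewrite det_ublock !det1 mulr1 normr1 invr1.
apply: volume_eq_slices => // a.
rewrite mul1e -[RHS](volume_translate (a *: w)); last first.
  exact: row_measurable_slice.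
congr volume; apply/funext => u /=; congr (A _).
by rewrite mul_row_block !mulmx1 mulmx0 addr0 mul_scalar_mx addrC.
Qed.

(** On the line over the tail [u] the shear is the translation by [u *m v]. *)
Lemma scales_volume_lshear n (v : 'cV[R]_n) :
  scales_volume (block_mx 1%:M 0 v 1%:M : 'M[R]_(1 + n)).
Proof.
move=> A mA; rewrite det_lblock !det1 mulr1 normr1 invr1.
apply: volume_eq_line_slices => //; first exact: row_measurable_linear.
move=> u; rewrite mul1e.
rewrite -[RHS](lebesgue_measure_translate ((u *m v) 0 0)); last first.
  exact: measurable_line_slice.
congr lebesgue_measure; apply/funext => a /=; congr (A _).
rewrite mul_row_block !mulmx1 mulmx0 add0r [X in _ + X](mx11_scalar).
by rewrite -raddfD.
Qed.

Lemma scales_volume_head n (c : R) : c != 0 ->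
  scales_volume (block_mx c%:M 0 0 1%:M : 'M[R]_(1 + n)).
Proof.
move=> c0 A mA; rewrite det_lblock det1 mulr1 det_scalar1.
apply: volume_eq_line_slices => //; first exact: row_measurable_linear.
move=> u; rewrite -lebesgue_measure_scale//; last first.
  exact: measurable_line_slice.
congr lebesgue_measure; apply/funext => a /=; congr (A _).
by rewrite mul_row_block mulmx1 !mulmx0 addr0 add0r -scalar_mxM.
Qed.

Lemma scales_volume_tail n (N : 'M[R]_n) : scales_volume N ->
  scales_volume (block_mx 1%:M 0 0 N : 'M[R]_(1 + n)).
Proof.
move=> hN A mA; rewrite det_lblock det1 mul1r.
apply: volume_eq_slices => // a; rewrite -hN; last exact: row_measurable_slice.
congr volume; apply/funext => u /=; congr (A _).
by rewrite mul_row_block mulmx1 !mulmx0 addr0 add0r.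
Qed.

(* Block Gaussian elimination; when the pivot vanishes, a shear by the transpose
   of the rest of the first column makes it a positive sum of squares. *)
Lemma scales_volume_unit n (M : 'M[R]_n) : M \in unitmx -> scales_volume M.
Proof.
elim: n => [|n IH] in M *; move=> uM.
  move=> A mA; rewrite det_mx00 normr1 invr1 mul1e.
  by congr volume; apply/funext => u /=; congr (A _); apply/rowP => -[].
have pivot (P : 'M[R]_(1 + n)) : P \in unitmx -> P 0 0 != 0 -> scales_volume P.
  set a := P 0 0 => uP a0.
  pose v := a^-1 *: dlsubmx P; pose w := a^-1 *: ursubmx P.
  (* The Schur complement of the pivot; it is invertible because its determinant is a factor of that
     of [P]. *)
  pose S := drsubmx P - v *m ursubmx P.
  have PE : P = block_mx 1%:M 0 v 1%:M *m (block_mx a%:M 0 0 1%:M *m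
      (block_mx 1%:M 0 0 S *m block_mx 1%:M w 0 1%:M)).
    rewrite !mulmx_block !(mul1mx, mulmx1, mul0mx, mulmx0, addr0, add0r).
    rewrite -{1}(submxK P); congr block_mx.
    - rewrite [LHS]mx11_scalar !mxE; congr (P _ _)%:M; exact: val_inj.
    - by rewrite mul_scalar_mx scalerA divff// scale1r.
    - by rewrite mul_mx_scalar scalerA divff// scale1r.
    - by rewrite mul_scalar_mx scalerA divff// scale1r addrC subrK.
  have uS : S \in unitmx.
    move: uP; rewrite PE !unitmxE !det_mulmx !unitrM => /and4P[_ _ + _].
    by rewrite det_lblock det1 mul1r.
  rewrite PE; apply: scales_volumeM; first exact: scales_volume_lshear.
  apply: scales_volumeM; first exact: scales_volume_head.
  apply: scales_volumeM; last exact: scales_volume_ushear.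
  exact/scales_volume_tail/IH.
change ('M[R]_(1 + n)) in M.
have [M0|] := eqVneq (M 0 0) 0; last exact: pivot.
pose c := dlsubmx M.
pose U (w : 'rV_n) : 'M[R]_(1 + n) := block_mx 1%:M w 0 1%:M.
have UM : M = U (- c^T) *m (U c^T *m M).
  rewrite mulmxA mulmx_block !(mul1mx, mulmx1, mul0mx, mulmx0, addr0, add0r).
  by rewrite subrr -scalar_mx_block mul1mx.
have uUM : U c^T *m M \in unitmx.
  by rewrite unitmx_mul uM andbT unitmxE det_ublock !det1 mulr1 unitr1.
rewrite UM; apply: scales_volumeM; first exact: scales_volume_ushear.
apply: pivot => //.
have -> : (U c^T *m M) 0 0 = dot c^T c^T.
  rewrite -[X in _ *m X](submxK M) mulmx_block.
  have e0 : (0 : 'I_(1 + n)) = lshift n 0 by exact: val_inj.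
  have ul0 : ulsubmx M 0 0 = 0.
    by rewrite !mxE -[RHS]M0; congr (M _ _); exact: val_inj.
  by rewrite e0 block_mxEul mul1mx mxE ul0 add0r /dot trmxK.
(* If [c] vanished along with [M 0 0], the whole first column of [M] would be zero, and so would its
   determinant. *)
rewrite dot_eq0; apply/eqP => c0.
move: uM; rewrite unitmxE unitfE (expand_det_col M 0) big1 ?eqxx// => i _.
have [k ->|k ->] := fintype.split_ordP i.
  by rewrite (_ : lshift n k = 0) ?M0 ?mul0r// ord1; exact: val_inj.
have /rowP/(_ k) := c0; rewrite !mxE => e.
rewrite (_ : M _ _ = 0) ?mul0r// -[RHS]e; congr (M _ _); exact: val_inj.
Qed.

Lemma volume_affine n (o : 'rV[R]_n) (M : 'M[R]_n) (A : set 'rV[R]_n) :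
  M \in unitmx -> row_measurable A ->
  volume [set u | A (o + u *m M)] = (`|\det M|^-1%:E * volume A)%E.
Proof.
move=> uM mA; rewrite -(volume_translate o mA).
rewrite -scales_volume_unit//; last first.
  exact: row_measurable_translate.
by congr volume; apply/funext => u /=; rewrite addrC.
Qed.

Definition box n (c : 'rV[R]_n) (e : R) : set 'rV[R]_n :=
  [set u | forall i, `|u 0 i - c 0 i| <= e].

(** By induction: a slice is a cube of one dimension less if its first coordinate is within [e] of
    that of [c], and empty otherwise. *)
Lemma volume_box n (c : 'rV[R]_n) (e : R) : 0 <= e ->
  volume (box c e) = ((2 * e) ^+ n)%:E.
Proof.
move=> e0; elim: n => [|n IH] in c *.
  rewrite /volume/= diracE mem_set//= => -[]//.
change ('rV[R]_(1 + n)) in c.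
change (volume (@box (1 + n) c e) = ((2 * e) ^+ n.+1)%:E).
rewrite (row_mx_split c).
set a := c 0 0; set w := rsubmx _.
pose I : set R := `[a - e, a + e]%classic.
rewrite volume_slices.
transitivity (\int[@lebesgue_measure R]_b
  ((\1_I b)%:E * ((2 * e) ^+ n)%:E))%E.
  apply: eq_integral => b _; rewrite -(IH w) indicE.
  have bI : (b \in I) = (`|b - a| <= e).
    by rewrite ler_distl; apply/idP/idP; rewrite inE /I/= in_itv.
  rewrite bI; case: (boolP (`|b - a| <= e)) => ba.
    rewrite mul1e; congr volume; apply/seteqP; split => u /= hu i.
      have := hu (rshift 1 i); by rewrite !row_mxEr.
    have [k ->|k ->] := fintype.split_ordP i; last by rewrite !row_mxEr.
    by rewrite !row_mxEl ord1 !mxE !eqxx.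
  rewrite mul0e; rewrite (_ : [set _ | _] = set0); first exact: measure0.
  apply/seteqP; split => u //= /(_ (lshift n 0)).
  by rewrite !row_mxEl !mxE !eqxx !mulr1n (negPf ba).
rewrite ge0_integralZr//; last 2 first.
- by apply/measurable_EFinP; apply: measurable_indic; exact: measurable_itv.
- by rewrite lee_fin exprn_ge0// mulr_ge0.
rewrite integral_indic//; last exact: measurable_itv.
rewrite (_ : I `&` _ = I); last exact: setIT.
rewrite /I/= lebesgue_measure_itv/= lte_fin.
rewrite -EFinB opprD addrACA subrr add0r opprK.
(* The interval formula tests [a - e < a + e]; its other branch forces [e = 0], where both sides
   vanish. *)
case: ltP => [_|]; first by rewrite -EFinM exprS mulr_natl.
rewrite lerD2l => ee.
have -> : e = 0 by apply/eqP; rewrite eq_le e0 andbT; lra.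
by rewrite mulr0 mul0e expr0n.
Qed.

Lemma row_measurable_box n (c : 'rV[R]_n) (e : R) : row_measurable (box c e).
Proof.
rewrite /row_measurable (_ : [set _ | _] = \bigcap_(k in [set: 'I_n])
  ([set: n.-tuple (measurableTypeR R)] `&`
    (fun t => row_of_tuple t 0 k : measurableTypeR R) @^-1`
    `[c 0 k - e, c 0 k + e]%classic)).
  apply: fin_bigcap_measurable => // k _.
  by apply: coord_measurable_row_of_tuple => //; exact: measurable_itv.
apply/seteqP; split=> t /= h k; rewrite ?setTI/=.
  by rewrite in_itv/= -ler_distl.
by have := h k I; rewrite setTI/= in_itv/= -ler_distl.
Qed.

Lemma le_volume n (A C : set 'rV[R]_n) : row_measurable A -> row_measurable C ->
  A `<=` C -> (volume A <= volume C)%E.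
Proof.
by move=> mA mC sAC; apply: le_measure; rewrite ?inE// => t; exact: sAC.
Qed.

(** The sum of [n] squares of size at most [(e / n)^2] is at most [e^2 / n]. This will bound the
    volume of the simplex from below. *)
Lemma box_sub_eball n (c : 'rV[R]_n) (e : R) : (0 < n)%N ->
  box c (e / n%:R) `<=` eball c e.
Proof.
move=> n_gt0 u hu; have n0 : 0 < n%:R :> R by rewrite ltr0n.
have e0 : 0 <= e.
  have := le_trans (normr_ge0 _) (hu (Ordinal n_gt0)).
  by rewrite pmulr_lge0// invr_gt0.
rewrite /eball/= -(@ler_pXn2r _ 2)// ?nnegrE ?enorm_ge0// enorm_sqr dotE.
apply: (@le_trans _ _ (\sum_(i < n) (e / n%:R) ^+ 2)).
  apply: ler_sum => i _; rewrite -expr2 -real_normK ?num_real//.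
  rewrite ler_pXn2r ?nnegrE ?divr_ge0// ?ler0n//.
  by have := hu i; rewrite !mxE.
rewrite sumr_const card_ord -[leLHS]mulr_natr exprMn -mulrA ler_piMr ?sqr_ge0//.
rewrite expr2 -mulrA mulVf ?gt_eqF// mulr1.
by rewrite invf_le1// ler1n.
Qed.

End VolumeAffine.

(** * Orthonormal frames *)

Section Frames.
Context {R : realType} {m : nat}.
Implicit Types (u v : 'rV[R]_(1 + m)) (Q : 'M[R]_(m, 1 + m)).

(** The Householder reflection [H] exchanging the first basis vector [e] with [v] is symmetric and
    orthogonal. Its first row is [v], and [Q] consists of the others. *)
Lemma householder_completion v : dot v v = 1 ->
  exists Q, col_mx v Q *m (col_mx v Q)^T = 1%:M.
Proof.
move=> vv; pose e : 'rV[R]_(1 + m) := row_mx 1%:M 0.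
suff [H HH eH] : exists2 H : 'M[R]_(1 + m), H *m H^T = 1%:M & e *m H = v.
  exists (dsubmx H); rewrite -eH.
  have -> : e *m H = usubmx H.
    by rewrite -{1}(vsubmxK H) mul_row_col mul1mx mul0mx addr0.
  by rewrite vsubmxK.
have ee : dot e e = 1.
  by rewrite /dot tr_row_mx mul_row_col trmx1 mul1mx mul0mx addr0 mxE.
(* For [e = v] there is no direction to reflect along; the identity matrix serves. *)
have [<-|ev] := eqVneq e v.
  by exists 1%:M; rewrite ?trmx1 mulmx1.
pose w := v - e; pose c := 2 / dot w w.
have w0 : dot w w != 0 by rewrite dot_eq0 subr_eq0 eq_sym.
have wwE : w *m w^T = (dot w w)%:M by rewrite [LHS]mx11_scalar.
have cw : c * dot w w = 2 by rewrite divfK.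
pose H : 'M[R]_(1 + m) := 1%:M - c *: (w^T *m w).
have HT : H^T = H.
  by rewrite /H linearB/= trmx1 linearZ/= trmx_mul trmxK.
exists H.
  have PP : (w^T *m w) *m (w^T *m w) = dot w w *: (w^T *m w).
    by rewrite mulmxA -(mulmxA w^T) wwE mul_mx_scalar -scalemxAl.
  rewrite HT /H mulmxBr mulmx1 mulmxBl mul1mx -scalemxAl -scalemxAr PP.
  rewrite !scalerA -mulrA cw mulr_natr mulr2n scalerDl.
  by rewrite opprB addrK subrK.
have ew : 2 * dot e w = - dot w w.
  rewrite /w !dotBr [dot (v - e) v]dotC [dot (v - e) e]dotC !dotBr vv ee.
  by rewrite [dot v e]dotC; ring.
rewrite /H mulmxBr mulmx1 -scalemxAr mulmxA [e *m _]mx11_scalar -/(dot e w).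
rewrite mul_scalar_mx scalerA.
have -> : c * dot e w = -1.
  by rewrite /c mulrAC ew mulNr divff.
by rewrite scaleN1r opprK addrC subrK.
Qed.

Lemma frame_decomp v Q u : col_mx v Q *m (col_mx v Q)^T = 1%:M ->
  u = (u *m v^T) *m v + (u *m Q^T) *m Q.
Proof.
move=> /mulmx1C; rewrite tr_col_mx mul_row_col => W.
by rewrite -!mulmxA -mulmxDr W mulmx1.
Qed.

Lemma orthogonal_normr_det n (W : 'M[R]_n) : W *m W^T = 1%:M -> `|\det W| = 1.
Proof.
move=> /(congr1 determinant); rewrite det_mulmx det_tr det1 -expr2 => /eqP.
by rewrite -real_normK ?num_real// pexpr_eq1// => /eqP.
Qed.

End Frames.

(** * Orthonormal frames of a facet hyperplane *)

Section FacetFrames.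
Context {R : realType} {m : nat}.
Variable x : 'I_(1 + m + 1) -> 'rV[R]_(1 + m).
Hypothesis hx : affinely_independent x.
Variable j : 'I_(1 + m + 1).

Let g := grad x j.
Let nu := (enorm g)^-1 *: g.

Let g_gt0 : 0 < enorm g.
Proof. exact: enorm_grad_gt0. Qed.

Let nunu : dot nu nu = 1.
Proof.
rewrite dotZl dotZr -enorm_sqr expr2 mulrA -invfM mulVf// mulf_neq0//;
by rewrite gt_eqF.
Qed.

Lemma vertex_face k : k != j -> face x j (x k).
Proof.
move=> kj; apply/faceP => //; split => [i|]; rewrite lagrange_vertex ?ler0n//.
by rewrite eq_sym (negPf kj).
Qed.

(** Completes the unit normal [nu] to an orthonormal basis. It ensures that [flat_measure] of a
    facet is not the default value of [xget]. *)
Lemma frame_exists : exists (o : 'rV[R]_(1 + m)) (Q : 'M[R]_(m, 1 + m)),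
  Q *m Q^T = 1%:M /\ face x j `<=` [set o + t *m Q | t in [set: 'rV[R]_m]].
Proof.
have [Q W] := householder_completion nunu.
have [k kj] := exists_other_vertex (ltn0Sn m) j.
exists (x k), Q; split.
  by move: W; rewrite tr_col_mx mul_col_row scalar_mx_block => /eq_block_mx[].
move=> y /(faceP hx)[_ yj]; exists ((y - x k) *m Q^T) => //.
have -> : (y - x k) *m Q^T *m Q = y - x k.
  (* The component along [nu] is zero, since the coordinate [j] vanishes at both [y] and [x k]. *)
  rewrite [RHS](frame_decomp _ W) [X in X *m nu]mx11_scalar -/(dot _ _) dotC.
  rewrite dotZl -lagrangeB yj lagrange_vertex// eq_sym (negPf kj) subrr mulr0.
  by rewrite raddf0 mul0mx add0r.
by rewrite addrC subrK.
Qed.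

Section Frame.
Variables (o : 'rV[R]_(1 + m)) (Q : 'M[R]_(m, 1 + m)).
Hypothesis QQ : Q *m Q^T = 1%:M.
Hypothesis hF : face x j `<=` [set o + t *m Q | t in [set: 'rV[R]_m]].

(** The frame chosen by [flat_measure] is known only through [QQ] and [hF]. The facet vertices lie
    in its span, which makes the row space of [Q] contain every vector orthogonal to [g]; these form
    a space of dimension [m], so the two spaces coincide. *)
Lemma frame_orthogonal : Q *m g^T = 0.
Proof.
apply: sub_kermxP.
have kerQ : (kermx g^T <= Q)%MS.
  apply/row_subP => i; set u := row i _.
  have gu : dot g u = 0.
    rewrite dotC /dot (_ : u *m _ = 0) ?mxE//.
    by apply: sub_kermxP; exact: row_sub.
  have /boolp.choice[T TE] : forall k, exists t : 'rV[R]_m,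
      k != j -> x k = o + t *m Q.
    move=> k; have [->|kj] := eqVneq k j; first by exists 0.
    by have [t _ tE] := hF (vertex_face kj); exists t.
  (* Weights with zero sum and [c j = 0] that express [u] by facet vertices alone; the zero sum
     cancels the origin [o]. *)
  pose c k := lagrange x k u - lagrange x k 0.
  have cj : c j = 0 by rewrite /c lagrangeB subr0.
  have c0 : \sum_k c k = 0 by rewrite sumrB !sum_lagrange// subrr.
  have cu : \sum_k c k *: x k = u.
    under eq_bigr do rewrite scalerBl.
    by rewrite sumrB (lagrange_decomp hx u).1 (lagrange_decomp hx 0).1 subr0.
  apply/submxP; exists (\sum_k c k *: T k).
  rewrite -cu mulmx_suml -[RHS]add0r -[X in X + _](scale0r o) -c0 scaler_suml.
  rewrite -big_split/=; apply: eq_bigr => k _.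
  have [->|kj] := eqVneq k j; first by rewrite cj !scale0r mul0mx addr0.
  by rewrite TE// scalerDr scalemxAl.
rewrite -(geq_leqif (mxrank_leqif_sup kerQ)) mxrank_ker mxrank_tr rank_rV.
rewrite -[g == 0]enorm_eq0 gt_eqF//= addKn.
exact: rank_leq_row.
Qed.

(** By orthogonality the coordinate is constant on the frame's affine span, which contains a vertex
    where it vanishes. *)
Lemma frame_lagrange t : lagrange x j (o + t *m Q) = 0.
Proof.
have lag u w : lagrange x j (o + u *m Q) = lagrange x j (o + w *m Q).
  apply/eqP; rewrite -subr_eq0 lagrangeB opprD addrACA subrr add0r -mulmxBl.
  by rewrite dotC /dot -mulmxA frame_orthogonal mulmx0 mxE.
have [k kj] := exists_other_vertex (ltn0Sn m) j.
have [u _ uE] := hF (vertex_face kj).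
by rewrite (lag t u) uE lagrange_vertex// eq_sym (negPf kj).
Qed.

Lemma frame_det : `|\det (col_mx (x j - o) Q)| = (enorm g)^-1.
Proof.
have Qnu : Q *m nu^T = 0.
  by rewrite linearZ/= -scalemxAr frame_orthogonal scaler0.
have W : col_mx nu Q *m (col_mx nu Q)^T = 1%:M.
  rewrite tr_col_mx mul_col_row QQ Qnu -[nu *m Q^T]trmxK trmx_mul trmxK Qnu.
  rewrite trmx0 (_ : nu *m nu^T = 1%:M) -?scalar_mx_block//.
  by rewrite [LHS]mx11_scalar -/(dot _ _) nunu.
set d := x j - o.
(* In the orthonormal basis [nu], [Q] the matrix is block triangular, with determinant [dot d nu],
   the height over the facet. *)
have -> : col_mx d Q =
    block_mx (d *m nu^T) (d *m Q^T) 0 1%:M *m col_mx nu Q.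
  by rewrite mul_block_col -frame_decomp// mul0mx mul1mx add0r.
rewrite det_mulmx normrM (orthogonal_normr_det W) mulr1 det_ublock det1 mulr1.
rewrite det_mx11 -/(dot _ _) dotC dotZl -lagrangeB lagrange_vertex// eqxx.
have := frame_lagrange 0; rewrite mul0mx addr0 => ->.
by rewrite subr0 mulr1 gtr0_norm ?invr_gt0.
Qed.

End Frame.
End FacetFrames.

(** * Measurability and volume bounds for the simplex *)

Section SimplexVolume.
Context {R : realType} {n : nat}.
Local Notation B := (measurableTypeR R).
Variable x : 'I_(n + 1) -> 'rV[R]_n.
Hypothesis hx : affinely_independent x.

Lemma measurable_lagrange k :
  measurable_fun [set: n.-tuple B] (fun t => lagrange x k (row_of_tuple t) : B).
Proof.
have mg : coord_measurable (fun t : n.-tuple B =>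
    const_mx (lagrange x k 0) + row_of_tuple t *m (grad x k)^T).
  apply: coord_measurableD; first exact: coord_measurable_cst.
  by apply: coord_measurable_mul; exact: coord_measurable_row_of_tuple.
apply: (eq_measurable_fun _ _ (mg 0)) => t _.
rewrite mxE [X in X + _]mxE -/(dot _ _) dotC -[X in dot _ X]subr0 -lagrangeB.
by rewrite addrC subrK.
Qed.

Lemma row_measurable_hull P : row_measurable (hull x P).
Proof.
rewrite /row_measurable (_ : [set _ | _] =
  \bigcap_(k in [set: 'I_(n + 1)]) ([set t | 0 <= lagrange x k (row_of_tuple t)]
  `&` [set t | ~~ P k -> lagrange x k (row_of_tuple t) = 0])); last first.
  apply/seteqP; split=> t /=.
    by move=> /(hullP hx)[t0 tP] k _; split; [exact: t0|exact: tP].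
  move=> h; apply/(hullP hx); split => k.
    by have [] := h k I.
  by have [_] := h k I.
apply: fin_bigcap_measurable => // k _; apply: measurableI.
  rewrite (_ : [set _ | _] = [set: n.-tuple B] `&`
    (fun t => lagrange x k (row_of_tuple t) : B) @^-1` `[0, +oo[%classic).
    by apply: measurable_lagrange => //; exact: measurable_itv.
  by rewrite setTI; apply/funext => t /=; rewrite in_itv/= andbT.
case: (P k) => /=.
  rewrite (_ : [set _ | _] = [set: n.-tuple B])//.
  by apply/seteqP; split.
rewrite (_ : [set _ | _] = [set: n.-tuple B] `&`
  (fun t => lagrange x k (row_of_tuple t) : B) @^-1` [set 0]).
  by apply: measurable_lagrange => //; exact: measurable_set1.
rewrite setTI; apply/seteqP; split => t /=; last by move=> ->.
exact.
Qed.

Lemma simplex_sub_box : simplex x `<=` box 0 (\sum_k enorm (x k)).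
Proof.
move=> _ [t [t0 _ t1 ->]] i; rewrite [X in _ - X]mxE subr0 summxE.
apply: le_trans (ler_norm_sum _ _ _) _; apply: ler_sum => k _.
rewrite mxE normrM ger0_norm//.
apply: le_trans (_ : 1 * `|x k 0 i| <= _); last by rewrite mul1r enorm_coord.
rewrite ler_wpM2r// -t1 (bigD1 k)//= lerDl sumr_ge0//.
Qed.

Hypothesis n_gt0 : (0 < n)%N.

(** The simplex lies between a cube inside its inscribed ball and a cube about the origin. So [fine]
    loses nothing, and division by the volume is legitimate. *)
Lemma volume_simplex_fin : exists2 r : R, 0 < r & volume (simplex x) = r%:E.
Proof.
have ub := le_volume (row_measurable_hull predT) (row_measurable_box _ _)
  simplex_sub_box.
have e0 : 0 < (gsum x)^-1 / n%:R.
  by rewrite divr_gt0 ?ltr0n// invr_gt0 gsum_gt0.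
have lb := le_volume (row_measurable_box _ _) (row_measurable_hull predT)
  (subset_trans (box_sub_eball (c := incenter x) (e := (gsum x)^-1) n_gt0)
    (inball_sub_simplex hx n_gt0)).
rewrite volume_box in lb; last exact: ltW.
rewrite volume_box in ub; last by apply: sumr_ge0 => k _; exact: enorm_ge0.
rewrite -/(simplex x) in lb ub.
move: lb ub; case: (volume _) => [r| |]//.
rewrite !lee_fin => lb _; exists r => //; apply: lt_le_trans lb.
by rewrite exprn_gt0// mulr_gt0.
Qed.

End SimplexVolume.

(** * The simplex as a cone over a facet *)

Section Cone.
Context {R : realType} {m : nat}.
Local Notation B := (measurableTypeR R).
Local Notation lambda := (@lebesgue_measure R).

Lemma integral_onemXn :
  (\int[lambda]_(a in `[0%R, 1%R]) ((1 - a : R) ^+ m)%:E)%E = (m.+1%:R^-1)%:E.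
Proof.
rewrite (@continuous_FTC2 _ _ (fun a => a.~ ^+ m.+1 / - m.+1%:R))//=.
- rewrite onem1 expr0n/= mul0r onem0 expr1n mul1r -EFinB sub0r.
  by rewrite -invrN opprK.
- by apply: continuous_in_subspaceT => a _; exact: continuous_onemXn.
- exact: derivable_oo_LRcontinuous_onemXnMr.
- move=> a _; rewrite derive1Mr//; last exact: onemXn_derivable.
  by rewrite derive_onemXn mulrAC divff// ?mul1r// oppr_eq0 pnatr_eq0.
Qed.

Variable x : 'I_(1 + m + 1) -> 'rV[R]_(1 + m).
Hypothesis hx : affinely_independent x.
Variables (j : 'I_(1 + m + 1)) (o : 'rV[R]_(1 + m)) (Q : 'M[R]_(m, 1 + m)).
Hypothesis hQ : forall t, lagrange x j (o + t *m Q) = 0.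

Let U := col_mx (x j - o) Q.
Let slice a := [set t : 'rV[R]_m | simplex x (o + row_mx a%:M t *m U)].
Let V := volume [set t : 'rV[R]_m | face x j (o + t *m Q)].

(** The point is [z + a (x j - z)], on the line from the point [z] of the facet hyperplane with
    coordinates [(1 - a)^-1 *: t] to the apex. *)
Let lagrange_slice a t k : a != 1 ->
  lagrange x k (o + row_mx a%:M t *m U) = a * (k == j)%:R +
    (1 - a) * lagrange x k (o + ((1 - a)^-1 *: t) *m Q).
Proof.
rewrite eq_sym -subr_eq0 => a1; set z := o + _ *m Q.
have -> : o + row_mx a%:M t *m U = z + a *: (x j - z).
  rewrite mul_row_col mul_scalar_mx /z -scalemxAl.
  have : t *m Q = (1 - a) *: ((1 - a)^-1 *: (t *m Q)).
    by rewrite scalerA divff// scale1r.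
  move: ((1 - a)^-1 *: (t *m Q)) => y ->.
  by apply/rowP => i; rewrite !mxE; ring.
rewrite -[LHS](subrK (lagrange x k z)) lagrangeB addrAC subrr add0r dotZr.
by rewrite -lagrangeB lagrange_vertex//; ring.
Qed.

(** The first coordinate in the frame [U] is the barycentric coordinate [j] itself. *)
Let slice_height a t : lagrange x j (o + row_mx a%:M t *m U) = a.
Proof.
have -> : o + row_mx a%:M t *m U = (o + t *m Q) + a *: (x j - (o + 0 *m Q)).
  by rewrite mul_row_col mul_scalar_mx mul0mx addr0 addrCA addrC.
rewrite -[LHS](subrK (lagrange x j (o + t *m Q))) lagrangeB addrAC subrr add0r.
by rewrite dotZr -lagrangeB !hQ lagrange_vertex// eqxx subr0 mulr1 addr0.
Qed.

Let volume_slice_out a : ~~ (0 <= a <= 1) -> volume (slice a) = 0%E.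
Proof.
move=> a01; rewrite (_ : slice a = set0); first exact: measure0.
apply/seteqP; split => t //= /(simplexP hx) h; move/negP: a01; apply.
rewrite -(slice_height a t) h/= -(sum_lagrange hx (o + row_mx a%:M t *m U)).
by rewrite [leRHS](bigD1 j)//= lerDl sumr_ge0.
Qed.

Let volume_slice_in a : 0 <= a < 1 ->
  volume (slice a) = (((1 - a) ^+ m)%:E * V)%E.
Proof.
move=> /andP[a0 a1]; have a1' : 0 < 1 - a by rewrite subr_gt0.
have -> : slice a = [set t | [set t : 'rV_m | face x j (o + t *m Q)]
    (t *m ((1 - a)^-1)%:M)].
  apply/funext => t; apply/propext; rewrite /slice/= mul_mx_scalar.
  rewrite (simplexP hx) (faceP hx); split => [h|[h _] k].
    split => // k; have [->|kj] := eqVneq k j; first by rewrite hQ.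
    have := h k; rewrite lagrange_slice; last by rewrite lt_eqF.
    rewrite (negPf kj) mulr0 add0r.
    by rewrite pmulr_rge0.
  rewrite lagrange_slice; last by rewrite lt_eqF.
  rewrite addr_ge0 ?mulr_ge0// ?ler0n//.
  exact: ltW.
rewrite scales_volume_unit; last 2 first.
- by rewrite unitmxE det_scalar unitrX// unitfE invr_eq0 gt_eqF.
- by apply: row_measurable_affine; exact: row_measurable_hull.
by rewrite det_scalar exprVn normfV invrK ger0_norm// exprn_ge0// ltW.
Qed.

Lemma volume_cone : U \in unitmx ->
  (`|\det U|^-1%:E * volume (simplex x))%E = ((m.+1%:R^-1)%:E * V)%E.
Proof.
move=> uU; have mS : row_measurable (simplex x) by exact: row_measurable_hull.
rewrite -(volume_affine o uU mS) volume_slices.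
have mslice := measurable_volume_slices (row_measurable_affine o U mS).
transitivity (\int[lambda]_(a in `[0%R, 1%R]) volume (slice a))%E.
  rewrite [RHS]integral_mkcond; apply: eq_integral => a _; rewrite patchE.
  by rewrite mem_setE in_itv/=; case: ifPn => // /volume_slice_out.
(* The endpoint 1, where the dilation by [(1 - a)^-1] breaks down, is dropped as a null set and
   restored after the substitution. *)
rewrite -integral_itv_bndo_bndc; last exact: measurable_funTS.
transitivity (\int[lambda]_(a in `[0%R, 1%R[) (((1 - a) ^+ m)%:E * V))%E.
  by apply: eq_integral => a; rewrite mem_setE in_itv/= => /volume_slice_in.
have mf (D : set B) : measurable_fun D (fun a : B => ((1 - a) ^+ m)%:E).
  apply/measurable_EFinP; apply: measurable_funX.
  by apply: measurable_funB => //; exact: measurable_id.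
rewrite integral_itv_bndo_bndc; last first.
  by apply: emeasurable_funM; [exact: mf|exact: measurable_cst].
rewrite ge0_integralZr ?integral_onemXn//.
- move=> a; rewrite /= in_itv/= lee_fin => /andP[_ a1].
  by rewrite exprn_ge0// subr_ge0.
- exact: volume_ge0.
Qed.

End Cone.

(** * Facet areas and the four equalities *)

Lemma facet_areaE (R : realType) (m : nat)
    (x : 'I_(1 + m + 1) -> 'rV[R]_(1 + m))
    (j : 'I_(1 + m + 1)) : affinely_independent x ->
  facet_area x j = m.+1%:R * fine (volume (simplex x)) / height x j.
Proof.
move=> hx; have g0 := enorm_grad_gt0 hx (ltn0Sn m) j.
have [r r0 rE] := volume_simplex_fin hx (ltn0Sn m).
rewrite heightE// invrK rE/= /facet_area /flat_measure.
(* The computation works for whichever frame is selected; [frame_exists] rules out the default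
   branch. *)
case: xgetP => [v _ [ o [Q [QQ hF ->]]]|noframe]; last first.
  have [ o [Q [QQ hF]]] := frame_exists hx j.
  by case: (noframe (volume [set t | face x j (o + t *m Q)])); exists o, Q.
have detU := frame_det hx QQ hF.
have uU : col_mx (x j - o) Q \in unitmx.
  by rewrite unitmxE unitfE -normr_eq0 detU invr_eq0 gt_eqF.
have := volume_cone hx (frame_lagrange hx hF) uU.
rewrite detU invrK rE -EFinM => /(congr1 (fun z => m.+1%:R%:E * z)%E).
rewrite muleA -!EFinM divff ?pnatr_eq0// mul1e => <- /=.
by rewrite -mulrA; congr (_ * _); rewrite mulrC.
Qed.

Theorem theorem1 (R : realType) (n : nat) (n_gt0 : (0 < n)%N)
    (x : 'I_(n + 1) -> 'rV[R]_n) (hx : affinely_independent x) :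
  [/\ alpha (eball 0 1) x =
        \sum_(j < n + 1) Num.sqrt (\sum_(i < n) l x (lshift 1 i) j ^+ 2),
      alpha (eball 0 1) x = \sum_(j < n + 1) 1 / height x j,
      alpha (eball 0 1) x = 1 / inradius x &
      alpha (eball 0 1) x =
        surface_area x / (n%:R * fine (volume (simplex x)))].
Proof.
have aE : alpha (eball 0 1) x = \sum_j 1 / height x j.
  by rewrite alphaE//; apply: eq_bigr => j _; rewrite heightE// div1r invrK.
split => //.
- by rewrite alphaE//; apply: eq_bigr => j _; rewrite enorm_grad.
- by rewrite alphaE// inradiusE// div1r invrK.
(* Writing [n] as a successor lets [n.-1] compute, so [facet_areaE] applies; each facet then
   contributes exactly [1 / height x j]. *)
case: n n_gt0 x hx aE => // m _ x hx ->.
have [r r0 rE] := volume_simplex_fin hx (ltn0Sn m).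
rewrite /surface_area mulr_suml; apply: eq_bigr => j _.
rewrite (facet_areaE (m := m))// rE/= mulrAC divff ?mul1r ?div1r//.
by rewrite mulf_neq0 ?pnatr_eq0// gt_eqF.
Qed.
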